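(* Let $C$ be a doubly even self-dual binary linear code of length $N$ with code-lattice $L$, let $r\mid N$, and let $\bar g\in\operatorname{Aut}C$ have cycle type $r^{N/r}$. Suppose that the fixed subcode $C^{\bar g}=\{c\in C:\bar g(c)=c\}$ has dimension $\frac1r\dim C$ and is spanned by codewords $B_1,\dots,B_{N/2r}$ (viewed as subsets of $\{1,\dots,N\}$) with $B_i\cap B_j=\emptyset$ for all $i\neq j$ and $\bigcup_i B_i=\{1,\dots,N\}$. Then the sublattice $L^g$ fixed by $g=\iota(\bar g)$ has theta series $\theta_{L^g}(q)=\vartheta_3(q^r)^{N/r}$. In particular the theta series of $L^g$ equals that of the lattice $A_1(r)^{N/r}$.
   Context: Binary linear codes, doubly even, self-dual as usual; codewords are identified with their supports $B\subseteq\{1,\dots,N\}$. $\operatorname{Aut}C=\{\sigma\in S_N:\sigma(C)=C\}$; cycle type $r^{N/r}$ means $\bar g$ is a product of $N/r$ disjoint $r$-cycles. Code-lattice: with $\langle\beta_i,\beta_j\rangle=\tfrac12\delta_{ij}$, $L=\{\sum_i a_i\beta_i:a_i\in\mathbb{Z},\ (a_i\bmod 2)_i\in C\}$, and $\iota(\sigma)(\beta_j)=\beta_{\sigma(j)}$. $L^g=\{\lambda\in L:g\lambda=\lambda\}$. $\theta_M(q)=\sum_{\lambda\in M}q^{\langle\lambda,\lambda\rangle/2}$. Jacobi theta function $\vartheta_3(q)=\sum_{n\in\mathbb{Z}}q^{n^2/2}$. Paper's convention: $A_1$ denotes the lattice $\mathbb{Z}$ with form $\langle x,y\rangle=xy$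 (so $\theta_{A_1}=\vartheta_3$), and $M(r)$ denotes the lattice $M$ with its form scaled by $r$. *)

(* Defs.v *)
From HB Require Import structures.
From mathcomp Require Export all_boot all_order all_fingroup all_algebra.
From mathcomp Require Export finmap.
From mathcomp Require Export boolp classical_sets functions cardinality fsbigop.

Set Implicit Arguments.
Unset Strict Implicit.
Unset Printing Implicit Defensive.

Import Order.TTheory GRing.Theory Num.Theory.

Local Open Scope ring_scope.

(* The coordinate permutation e_j |-> e_(s j).  On codewords it acts on
   supports by B |-> s(B); on the basis beta_j of the code-lattice it is
   iota(s). *)
Definition coord_perm (R : comNzRingType) N (s : 'S_N) (a : 'rV[R]_N) : 'rV[R]_N :=
  \sum_j a 0 j *: delta_mx 0 (s j).

Fact coord_perm_linear (R : comNzRingType) N (s : 'S_N) :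
  linear (@coord_perm R N s).
Proof.
move=> k a b; rewrite /coord_perm scaler_sumr -big_split /=.
by apply: eq_bigr => j _; rewrite !mxE scalerDl scalerA.
Qed.

HB.instance Definition _ (R : comNzRingType) N (s : 'S_N) :=
  GRing.isLinear.Build R 'rV[R]_N 'rV[R]_N *:%R (@coord_perm R N s)
    (@coord_perm_linear R N s).

Local Notation word N := 'rV['F_2]_N.
Local Notation code N := {vspace word N}.

Definition supp N (c : word N) : {set 'I_N} := [set i | c 0 i != 0].

Lemma supp_coord_perm N (s : 'S_N) (c : word N) :
  supp (coord_perm s c) = s @: supp c.
Proof.
have E i : coord_perm s c 0 (s i) = c 0 i.
  rewrite summxE (bigD1 i) //= !mxE !eqxx mulr1 big1 ?addr0 // => j ji.
  by rewrite !mxE eqxx (inj_eq perm_inj) eq_sym (negPf ji) mulr0.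
apply/setP=> k; have -> : k = s (s^-1%g k) by rewrite permKV.
by rewrite inE E mem_imset ?inE //; apply: perm_inj.
Qed.

Definition doubly_even N (C : code N) :=
  forall c, c \in C -> (4 %| #|supp c|)%N.

Definition dotF2 N (x y : word N) : 'F_2 := \sum_i x 0 i * y 0 i.

Definition self_dual N (C : code N) :=
  forall x, x \in C <-> (forall c, c \in C -> dotF2 x c = 0).

Definition Aut_code N (C : code N) : {set 'S_N} :=
  [set s | (linfun (coord_perm s) @: C == C)%VS].

Definition fixed_subcode N (C : code N) (s : 'S_N) : code N :=
  (C :&: fixedSpace (linfun (coord_perm s)))%VS.

(* Cycle type r^m; fixed points are 1-cycles. *)
Definition has_cycle_type_pow N (s : 'S_N) (r m : nat) :=
  #|porbits s| = m /\ (forall X, X \in porbits s -> #|X| = r).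

(* A lattice is an additive subgroup [points] of an ambient group carrying a
   rational-valued symmetric biadditive form.  Finite rank and positive
   definiteness are not part of the structure. *)
Record lattice := Lattice {
  ambient : zmodType;
  points : set ambient;
  form : ambient -> ambient -> rat;
  points0 : points 0;
  pointsB : forall x y, points x -> points y -> points (x - y);
  formC : forall x y, form x y = form y x;
  formD : forall x y z, form (x + y) z = form x z + form y z }.

Section CodeLattice.
Variables (N : nat) (C : code N).

(* The row vector a stands for \sum_i a_i beta_i, <beta_i, beta_j> = delta_ij/2. *)
Definition code_lattice_points : set 'rV[int]_N :=
  [set a | map_mx (intr : int -> 'F_2) a \in C]%classic.

Definition code_lattice_form (a b : 'rV[int]_N) : rat :=
  \sum_i 2^-1 * (a 0 i)%:~R * (b 0 i)%:~R.

Fact code_lattice_points0 : code_lattice_points 0.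
Proof. by rewrite /code_lattice_points /= map_mx0 mem0v. Qed.

Fact code_lattice_pointsB x y :
  code_lattice_points x -> code_lattice_points y -> code_lattice_points (x - y).
Proof. by rewrite /code_lattice_points /= map_mxB; apply: rpredB. Qed.

Fact code_lattice_formC x y : code_lattice_form x y = code_lattice_form y x.
Proof. by apply: eq_bigr => i _; rewrite mulrAC. Qed.

Fact code_lattice_formD x y z :
  code_lattice_form (x + y) z = code_lattice_form x z + code_lattice_form y z.
Proof.
by rewrite -big_split; apply: eq_bigr => i _; rewrite mxE rmorphD mulrDr mulrDl.
Qed.

Definition code_lattice : lattice :=
  Lattice code_lattice_points0 code_lattice_pointsB
          code_lattice_formC code_lattice_formD.

End CodeLattice.

Section FixedLattice.
Variables (M : lattice) (f : {additive ambient M -> ambient M}).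

Definition fixed_points : set (ambient M) :=
  [set x | points x /\ f x = x]%classic.

Fact fixed_points0 : fixed_points 0.
Proof. by split; [exact: points0 | exact: raddf0]. Qed.

Fact fixed_pointsB x y :
  fixed_points x -> fixed_points y -> fixed_points (x - y).
Proof.
by move=> [Mx fx] [My fy]; split; [exact: pointsB | rewrite raddfB fx fy].
Qed.

Definition fixed_lattice : lattice :=
  Lattice fixed_points0 fixed_pointsB (@formC M) (@formD M).

End FixedLattice.

Section A1.

Definition A1_form (x y : int) : rat := x%:~R * y%:~R.

Fact A1_formC x y : A1_form x y = A1_form y x.
Proof. exact: mulrC. Qed.

Fact A1_formD x y z : A1_form (x + y) z = A1_form x z + A1_form y z.
Proof. by rewrite /A1_form rmorphD mulrDl. Qed.

(* The integers with form xy, not the root lattice of norm 2. *)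
Definition A1 : lattice :=
  @Lattice int setT A1_form I (fun _ _ _ _ => I) A1_formC A1_formD.

End A1.

Section ScaledLattice.
Variables (M : lattice) (r : nat).

Definition scaled_form (x y : ambient M) : rat := r%:R * form x y.

Fact scaled_formC x y : scaled_form x y = scaled_form y x.
Proof. by rewrite /scaled_form formC. Qed.

Fact scaled_formD x y z :
  scaled_form (x + y) z = scaled_form x z + scaled_form y z.
Proof. by rewrite /scaled_form formD mulrDr. Qed.

Definition scaled_lattice : lattice :=
  Lattice (@points0 M) (@pointsB M) scaled_formC scaled_formD.

End ScaledLattice.

(* The orthogonal direct sum of m copies of M. *)
Section PowerLattice.
Variables (M : lattice) (m : nat).

Definition power_points : set {ffun 'I_m -> ambient M} :=
  [set x | forall i, points (x i)]%classic.

Definition power_form (x y : {ffun 'I_m -> ambient M}) : rat :=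
  \sum_i form (x i) (y i).

Fact power_points0 : power_points 0.
Proof. by move=> i; rewrite ffunE; exact: points0. Qed.

Fact power_pointsB x y :
  power_points x -> power_points y -> power_points (x - y).
Proof. by move=> Mx My i; rewrite !ffunE; exact: pointsB. Qed.

Fact power_formC x y : power_form x y = power_form y x.
Proof. by apply: eq_bigr => i _; exact: formC. Qed.

Fact power_formD x y z :
  power_form (x + y) z = power_form x z + power_form y z.
Proof.
by rewrite -big_split; apply: eq_bigr => i _; rewrite ffunE formD.
Qed.

Definition power_lattice : lattice :=
  Lattice power_points0 power_pointsB power_formC power_formD.

End PowerLattice.

(* Formal series \sum_e f(e) q^e with rational exponents e and integer
   coefficients. *)
Definition qseries := rat -> int.

Definition qone : qseries := fun e => (e == 0)%:R.

(* Cauchy product.  The sum is over the finite support of its summand; it is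
   finite when f and g have non-negative exponents in a fixed (1/d)Z, as all
   the series below do. *)
Definition qmul (f g : qseries) : qseries :=
  fun e => \sum_(a \in [set: rat]%classic) f a * g (e - a).

Definition qpow (f : qseries) (n : nat) : qseries := iter n (qmul f) qone.

(* The substitution q |-> q^r, for r > 0. *)
Definition qsubst (f : qseries) (r : nat) : qseries := fun e => f (e / r%:R).

(* \sum_(x in A) q^(phi x): the coefficient of q^e is the number of x in A with
   phi x = e (for infinitely many such x it would be 0; this does not happen
   for a positive definite lattice of finite rank). *)
Definition qsum (T : choiceType) (A : set T) (phi : T -> rat) : qseries :=
  fun e => (#|` fset_set [set x | A x /\ phi x = e]%classic|%fset)%:Z.

Definition theta (M : lattice) : qseries :=
  qsum (@points M) (fun x => form x x / 2).

Definition vartheta3 : qseries :=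
  qsum [set: int]%classic (fun n => n%:~R ^+ 2 / 2).

Lemma theta_A1 : theta A1 = vartheta3.
Proof. by []. Qed.

(* Main.v *)
(* For a codeword c, the trace of c under <g> lies in the span of the disjoint
   words B_i, so c meets any two distinct g-orbits O, O' inside one block B_i with the
   same parity.  Hence the indicator of O + O' is orthogonal to C, so it lies in
   C by self-duality, and then in C^g; being constant on B_i it forces
   B_i = O + O'.  So a block contains at most two orbits, and since N/r orbits
   are covered by at most (N/r)/2 blocks, every block has exactly two.  A vector
   of L^g is therefore a family of pairs of integers of equal parity, i.e.
   (x + y, x - y), whose norm r ((x + y)^2 + (x - y)^2) / 2 = r (x^2 + y^2)
   is that of (x, y) in A_1(r)^2. *)
Require Import Defs.
From mathcomp Require Import zify ring lra.
Import Order.TTheory GRing.Theory Num.Theory.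
Set Implicit Arguments.
Unset Strict Implicit.
Unset Printing Implicit Defensive.

Local Open Scope ring_scope.

(** * Counting series of locally finite weighted sets *)

(** Sublevel sets, and not merely level sets, are required to be finite, so that the property passes
    to products and the sum in [qmul] is finite. *)
Definition locally_finite (T : choiceType) (A : set T) (phi : T -> rat) :=
  (forall x, A x -> 0 <= phi x) /\
  forall e, finite_set [set x | A x /\ phi x <= e]%classic.

Lemma qsum_bij (T U : choiceType) (A : set T) (A' : set U)
    (phi : T -> rat) (psi : U -> rat) (f : T -> U) :
  injective f -> (f @` A = A')%classic -> (forall x, A x -> psi (f x) = phi x) ->
  qsum A' psi = qsum A phi.
Proof.
move=> f_inj fA psif; apply/funext => e; rewrite /qsum.
set S := [set x | A x /\ phi x = e]%classic.
have -> : [set y | A' y /\ psi y = e]%classic = (f @` S)%classic.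
  rewrite -fA; apply/seteqP; split=> [y [[x Ax <-] psie]|_ [x [Ax phie] <-]] /=.
    by exists x; split=> //; rewrite -psif.
  by split; [exists x | rewrite psif].
have [Sfin|Sinf] := pselect (finite_set S).
  by rewrite fset_set_image // card_imfset.
have fSinf : ~ finite_set (f @` S)%classic.
  by rewrite (eq_finite_set (inj_card_eq _)) // => x y _ _; apply: f_inj.
(* [fset_set] of an infinite set is empty, so both coefficients are 0. *)
by rewrite /fset_set; case: pselect => //; case: pselect.
Qed.

Lemma locally_finite_bij (T U : choiceType) (A : set T) (A' : set U)
    (phi : T -> rat) (psi : U -> rat) (f : T -> U) :
  (f @` A = A')%classic -> (forall x, A x -> psi (f x) = phi x) ->
  locally_finite A phi -> locally_finite A' psi.
Proof.
move=> <- psif [phi0 Afin]; split=> [_ [x Ax <-]|e]; first by rewrite psif ?phi0.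
apply: sub_finite_set (finite_image f (Afin e)) => _ [[x Ax <-] /=].
by rewrite psif // => xe; exists x.
Qed.

(** [X] may be larger than the level set, so one finite sum over [X] can serve many exponents at
    once. *)
Lemma qsum_fset (T : choiceType) (A : set T) (phi : T -> rat) (X : {fset T}) e :
  (forall x, x \in X -> A x) -> (forall x, A x -> phi x = e -> x \in X) ->
  qsum A phi e = \sum_(x <- X) (phi x == e)%:R.
Proof.
move=> XA AX; rewrite /qsum.
have -> : [set x | A x /\ phi x = e]%classic
          = [set` [fset x in X | phi x == e]%fset]%classic.
  apply/seteqP; split=> x /=; rewrite !inE /=.
    by move=> [Ax phie]; rewrite (AX x Ax phie) phie eqxx.
  by move=> /andP[xX /eqP]; split=> //; apply: XA.
rewrite set_fsetK card_fset_sum1 big_fset /= (big_morph Posz PoszD erefl).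
by rewrite [LHS]big_mkcond; apply: eq_bigr => x _; case: (phi x == e).
Qed.

Lemma locally_finite_setX (T U : choiceType) (A : set T) (A' : set U)
    (phi : T -> rat) (psi : U -> rat) :
  locally_finite A phi -> locally_finite A' psi ->
  locally_finite (A `*` A')%classic (fun p => phi p.1 + psi p.2).
Proof.
move=> [phi0 Afin] [psi0 A'fin]; split=> [p [/phi0 ? /psi0 ?]|e].
  exact: addr_ge0.
apply: sub_finite_set (finite_setX (Afin e) (A'fin e)) => -[x y] /= [[Ax A'y] le_e].
by move: (phi0 x Ax) (psi0 y A'y) => ? ?; split; split=> //; lra.
Qed.

Lemma qmul_qsum (T U : choiceType) (A : set T) (A' : set U)
    (phi : T -> rat) (psi : U -> rat) :
  locally_finite A phi -> locally_finite A' psi ->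
  qmul (qsum A phi) (qsum A' psi)
  = qsum (A `*` A')%classic (fun p => phi p.1 + psi p.2).
Proof.
move=> [phi0 Afin] [psi0 A'fin]; apply/funext => e.
(* Weights are nonnegative, so every pair of total weight [e] has its components in [X] and [Y]. *)
pose X := fset_set [set x | A x /\ phi x <= e]%classic.
pose Y := fset_set [set y | A' y /\ psi y <= e]%classic.
have XE x : x \in X <-> A x /\ phi x <= e by rewrite in_fset_set // inE.
have YE y : y \in Y <-> A' y /\ psi y <= e by rewrite in_fset_set // inE.
rewrite (@qsum_fset _ _ _ (X `*` Y)%fset); first last.
- move=> [x y] /= [Ax A'y] exy; rewrite in_fsetE /=.
  move: (phi0 x Ax) (psi0 y A'y) => ? ?.
  by apply/andP; split; [apply/XE|apply/YE]; split=> //; lra.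
- by move=> [x y]; rewrite in_fsetE => /andP[/XE[? _] /YE[? _]].
have phiX (a : rat) : a <= e -> qsum A phi a = \sum_(x <- X) (phi x == a)%:R.
  move=> ae; apply: qsum_fset => x => [/XE[]//|Ax xa].
  by apply/XE; rewrite xa.
have psiY (a : rat) : 0 <= a ->
  qsum A' psi (e - a) = \sum_(y <- Y) (psi y == e - a)%:R.
  move=> a0; apply: qsum_fset => y => [/YE[]//|A'y ya].
  by apply/YE; rewrite ya; split=> //; lra.
have qsum_lt0 (V : choiceType) (D : set V) (f : V -> rat) a :
  (forall x, D x -> 0 <= f x) -> a < 0 -> qsum D f a = 0.
  move=> f0 a0; rewrite (@qsum_fset _ _ _ fset0) ?big_seq_fset0 // => x Dx fx.
  by move: (f0 x Dx); rewrite fx leNgt a0.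
(* An exponent [a] outside [phi(X)] contributes 0: if [a < 0] or [a > e], one factor has a negative
   exponent; otherwise no element of [X] has weight [a]. *)
rewrite /qmul (fsbigTE [fset phi x | x in X]%fset); last first.
  move=> a aX; have [a0|a0] := ltP a 0; first by rewrite qsum_lt0 ?mul0r.
  have [ae|ae] := leP a e; last by rewrite [X in _ * X]qsum_lt0 ?mulr0 //; lra.
  rewrite phiX // big1_seq ?mul0r // => x /andP[_ xX].
  by case: eqP => // xa; case/negP: aX; rewrite -xa in_imfset.
rewrite big_imfset2 /=; last by move=> [x y] [x' y'] _ _ [-> ->].
(* The pairs are grouped by the weight of their first component. *)
rewrite [RHS](partition_big_imfset _ phi).
apply: eq_big_seq => a /imfsetP[x /= /XE[Ax xe] ->].
rewrite phiX // psiY ?phi0 // big_distrl /= [RHS]big_mkcond.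
apply: eq_bigr => x' _; case: eqP => [->|]; last by rewrite mul0r.
rewrite mul1r; apply: eq_bigr => y _.
by rewrite eq_sym subr_eq addrC eq_sym.
Qed.

(** * Powers of counting series *)

Section Power.
Variables (T : choiceType) (A : set T) (phi : T -> rat).

Definition ffun_cons m (p : T * {ffun 'I_m -> T}) : {ffun 'I_m.+1 -> T} :=
  [ffun i => oapp p.2 p.1 (unlift ord0 i)].

Lemma ffun_cons0 m (p : T * {ffun 'I_m -> T}) : ffun_cons p ord0 = p.1.
Proof. by rewrite ffunE unlift_none. Qed.

Lemma ffun_consS m (p : T * {ffun 'I_m -> T}) i :
  ffun_cons p (lift ord0 i) = p.2 i.
Proof. by rewrite ffunE liftK. Qed.

Lemma ffun_cons_inj m : injective (@ffun_cons m).
Proof.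
move=> [x u] [y v] /ffunP xuyv; congr (_, _).
  by move: (xuyv ord0); rewrite !ffun_cons0.
by apply/ffunP => i; move: (xuyv (lift ord0 i)); rewrite !ffun_consS.
Qed.

Definition power_set m : set {ffun 'I_m -> T} := [set x | forall i, A (x i)]%classic.

Definition power_sum m (x : {ffun 'I_m -> T}) : rat := \sum_i phi (x i).

Lemma image_ffun_cons m :
  (@ffun_cons m @` (A `*` @power_set m) = @power_set m.+1)%classic.
Proof.
apply/seteqP; split=> [_ [[x u] [/= Ax Au] <-] i|x Ax] /=.
  by case: (unliftP ord0 i) => [j|] ->; rewrite (ffun_cons0, ffun_consS).
exists (x ord0, [ffun i => x (lift ord0 i)]).
  by split=> [|i] /=; rewrite ?ffunE; apply: Ax.
apply/ffunP => i.
by case: (unliftP ord0 i) => [j|] ->; rewrite (ffun_cons0, ffun_consS) ?ffunE.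
Qed.

Lemma power_sum_cons m (p : T * {ffun 'I_m -> T}) :
  power_sum (ffun_cons p) = phi p.1 + power_sum p.2.
Proof.
rewrite /power_sum big_ord_recl ffun_cons0; congr (_ + _).
by apply: eq_bigr => i _; rewrite ffun_consS.
Qed.

Hypothesis A_fin : locally_finite A phi.

Lemma locally_finite_power m : locally_finite (@power_set m) (@power_sum m).
Proof.
elim: m => [|m IHm].
  split=> [x _|e]; first by rewrite /power_sum big_ord0.
  apply: sub_finite_set (finite_set1 (ffun0 (card_ord 0) : {ffun 'I_0 -> T})).
  by move=> x _; apply/ffunP => -[].
by apply: locally_finite_bij (image_ffun_cons m) _ (locally_finite_setX A_fin IHm)
  => p _; apply: power_sum_cons.
Qed.

(** By induction: one more factor counts pairs, which [ffun_cons] identifies with families longer by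
    one. *)
Lemma qpow_qsum m : qpow (qsum A phi) m = qsum (@power_set m) (@power_sum m).
Proof.
elim: m => [|m IHm].
  apply/funext => e; rewrite /qpow /= /qone.
  pose x0 : {ffun 'I_0 -> T} := ffun0 (card_ord 0).
  have x0E x : x = x0 by apply/ffunP => -[].
  rewrite (@qsum_fset _ _ _ [fset x0]%fset); first last.
  - by move=> x _ _; rewrite (x0E x) in_fset1.
  - by move=> x _ [].
  by rewrite big_seq_fset1 /power_sum big_ord0 eq_sym; case: eqP.
rewrite /qpow iterS -/(qpow _ m) IHm (qmul_qsum A_fin (locally_finite_power m)).
symmetry; apply: qsum_bij (@ffun_cons_inj m) (image_ffun_cons m) _ => p _.
exact: power_sum_cons.
Qed.

End Power.

(** * Theta series of orthogonal powers and of scaled lattices *)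

Lemma theta_power_lattice (M : lattice) m :
  locally_finite (@points M) (fun x => form x x / 2) ->
  theta (power_lattice M m) = qpow (theta M) m.
Proof.
move=> Mfin; rewrite /theta qpow_qsum //; congr qsum.
by apply/funext => x; rewrite /power_sum -mulr_suml.
Qed.

Lemma theta_scaled_lattice (M : lattice) r :
  (0 < r)%N -> theta (scaled_lattice M r) = qsubst (theta M) r.
Proof.
move=> r0; have r0' : r%:R != 0 :> rat by rewrite pnatr_eq0 -lt0n.
apply/funext => e; rewrite /theta /qsubst /qsum; congr (#|` fset_set _ |%fset)%:Z.
apply/seteqP; split=> x [Mx /= xe]; split=> //=.
  by rewrite -xe /scaled_form; field.
by rewrite /scaled_form -mulrA xe; field.
Qed.

Lemma locally_finite_scaled_A1 r :
  (0 < r)%N ->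
  locally_finite (@points (scaled_lattice A1 r)) (fun x => form x x / 2).
Proof.
move=> r0; have r0' : 1 <= r%:R :> rat by rewrite ler1n.
split=> [x _|e] /=; rewrite /scaled_form /= /A1_form.
  by apply: mulr_ge0 => //; apply: mulr_ge0; rewrite ?ler0n -?expr2 ?sqr_ge0.
(* As [r >= 1], weight at most [e] gives [x ^ 2 <= 2 e < k], so [x] lies between [-k] and [k],
   within a shift of the naturals below [k + k]. *)
have [k ek] : exists k : nat, `|e * 2| < k%:R.
  by exists (Num.bound `|e * 2|); apply: archi_boundP.
apply: sub_finite_set
  (finite_image (fun n : nat => n%:Z - k%:Z) (finite_II (k + k))).
move=> /= x [_ xe].
have : x%:~R * x%:~R < k%:R :> rat.
  have : 0 <= x%:~R * x%:~R :> rat by rewrite -expr2 sqr_ge0.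
  have := ler_norm (e * 2); nra.
rewrite -[k%:R]/(k%:Z%:~R) -rmorphM /= ltr_int => xk.
by exists (absz (x + k%:Z)%R) => /=; nia.
Qed.

(** * Coordinate permutations and orbits *)

Section CoordPerm.
Variables (R : comNzRingType) (N : nat).
Implicit Types (s t : 'S_N) (a : 'rV[R]_N).

Lemma coord_permE s a j : coord_perm s a 0 j = a 0 ((s^-1)%g j).
Proof.
rewrite summxE (bigD1 ((s^-1)%g j)) //= !mxE permKV !eqxx mulr1 big1 ?addr0 //.
move=> k kj; rewrite !mxE eqxx /=; case: eqP => [jk|]; last by rewrite mulr0.
by rewrite jk permK eqxx in kj.
Qed.

Lemma coord_permM s t a : coord_perm (s * t)%g a = coord_perm t (coord_perm s a).
Proof. by apply/rowP => j; rewrite !coord_permE invMg permM. Qed.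

Lemma coord_perm_fixedP s a :
  coord_perm s a = a <-> (forall j k, porbit s j = porbit s k -> a 0 j = a 0 k).
Proof.
split=> [sa j k /eqP|orb_a].
  rewrite eq_porbit_mem => /porbitP[i ->].
  elim: i => [|i IHi]; first by rewrite perm1.
  by rewrite expgSr permM -{1}sa coord_permE permK.
apply/rowP => j; rewrite coord_permE; apply: orb_a; symmetry.
by rewrite -{1}[j](permKV s) -[X in porbit s (fun_of_perm X _)]expg1 porbit_perm.
Qed.

Lemma sum_coord_perm_expg s a j :
  (\sum_(i < #|porbit s j|) coord_perm (s ^+ i)%g a) 0 j
  = \sum_(k in porbit s j) a 0 k.
Proof.
(* The [i]-th summand reads the entry at [s^-i j], so the orbit is listed by powers of the
   inverse. *)
rewrite summxE -porbitV; under [RHS]eq_bigl do rewrite porbit_traject.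
rewrite -big_uniq ?uniq_traject_porbit //= (big_nth j) size_traject big_mkord.
apply: eq_bigr => i _; rewrite nth_traject ?ltn_ord //.
by rewrite coord_permE -permX expgVn.
Qed.

End CoordPerm.

(** * Arithmetic modulo 2 *)

Lemma neq0_F2 (x : 'F_2) : x != 0 -> x = 1.
Proof. by case: x => -[|[|[]]] // x2 _; apply: val_inj. Qed.

Lemma addrr_F2 (x : 'F_2) : x + x = 0.
Proof. by case: x => -[|[|[]]] // x2; apply: val_inj. Qed.

Lemma intr_F2_eqP (x y : int) : x%:~R = y%:~R :> 'F_2 <-> exists z, x = y + z *+ 2.
Proof.
have ch2 : 2 \in [pchar 'F_2] by apply: pchar_Fp.
split=> [xy|[z ->]].
  have : (2 %| (x - y)%R)%Z by rewrite (dvdz_pcharf ch2) rmorphB /= xy subrr.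
  by case/dvdzP => z xyz; exists z; rewrite mulr2n; lia.
by rewrite mulr2n !rmorphD /= addrr_F2 addr0.
Qed.

Lemma mem_supp N (c : 'rV['F_2]_N) j : (j \in supp c) = (c 0 j != 0).
Proof. by rewrite inE. Qed.

(** * Spans of words with disjoint supports *)

Section DisjointSpan.
Variables (N n : nat) (B : n.-tuple 'rV['F_2]_N).
Hypothesis B_disj :
  forall i j, i != j -> [disjoint supp (tnth B i) & supp (tnth B j)].

Lemma tnth_disjoint_supp i i' j :
  j \in supp (tnth B i) -> tnth B i' 0 j = (i' == i)%:R.
Proof.
move=> ji; case: eqP => [->|/eqP ii']; first by apply: neq0_F2; rewrite -mem_supp.
have := disjointFl (B_disj ii') ji.
by rewrite mem_supp => /eqP.
Qed.

Lemma disjoint_supp_uniq i i' j :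
  j \in supp (tnth B i) -> j \in supp (tnth B i') -> i' = i.
Proof.
move=> ji; rewrite mem_supp (tnth_disjoint_supp i' ji).
by case: (i' =P i) => //; rewrite eqxx.
Qed.

(** Each generator is constant on each block, hence so is any combination. *)
Lemma span_disjoint_supp (x : 'rV['F_2]_N) i j k :
  x \in <<B>>%VS -> j \in supp (tnth B i) -> k \in supp (tnth B i) ->
  x 0 j = x 0 k.
Proof.
move=> /coord_span -> ji ki; rewrite !summxE; apply: eq_bigr => i' _.
by rewrite !mxE -tnth_nth (tnth_disjoint_supp i' ji) (tnth_disjoint_supp i' ki).
Qed.

Lemma mem_span_disjoint_supp (x : 'rV['F_2]_N) :
  (forall j, exists i, j \in supp (tnth B i)) ->
  (forall i j k, j \in supp (tnth B i) -> k \in supp (tnth B i) ->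
     x 0 j = x 0 k) ->
  x \in <<B>>%VS.
Proof.
move=> cov xB.
(* The coefficient is the common value of [x] on the block; an empty support means a zero word, for
   which the default 0 is harmless. *)
pose a i := if [pick j in supp (tnth B i)] is Some j then x 0 j else 0.
have -> : x = \sum_i a i *: tnth B i.
  apply/rowP => j; have [i ji] := cov j.
  rewrite summxE (bigD1 i) //= mxE (tnth_disjoint_supp i ji) eqxx mulr1.
  rewrite big1 ?addr0 => [|i' /negPf ii']; last first.
    by rewrite mxE (tnth_disjoint_supp i' ji) ii' mulr0.
  by rewrite /a; case: pickP => [k ki|/(_ j)]; [apply: xB ji ki | rewrite ji].
by apply: memv_suml => i _; apply/memvZ/memv_span/mem_tnth.
Qed.

End DisjointSpan.

(** * The Hadamard map on pairs of integers *)

(* Each pair of coordinates [(x, y)] of [u], at positions [i] and [n + i],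
   becomes the pair [(x + y, x - y)] on the two fibres of [h] over [i]. *)
Definition hadamard_row (N n : nat) (h : 'I_N -> 'I_n * bool)
    (u : {ffun 'I_(n + n) -> int}) : 'rV[int]_N :=
  \row_j (u (lshift n (h j).1)
          + (if (h j).2 then - u (rshift n (h j).1) else u (rshift n (h j).1))).

(** Since every label is attained, both [x + y] and [x - y] can be read off, and they determine [x]
    and [y] over the integers. *)
Lemma hadamard_row_inj N n (h : 'I_N -> 'I_n * bool) :
  (forall ib, exists j, h j = ib) -> injective (hadamard_row h).
Proof.
move=> h_surj u v /rowP uv.
have uvE i b : u (lshift n i) + (if b then - u (rshift n i) else u (rshift n i))
             = v (lshift n i) + (if b then - v (rshift n i) else v (rshift n i)).
  by have [j hj] := h_surj (i, b); have := uv j; rewrite !mxE hj.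
apply/ffunP => k; case: (split_ordP k) => i ->;
  by move: (uvE i true) (uvE i false) => /=; lia.
Qed.

(** Each fibre of [h] contributes [r] equal squares, and the factor 1/2 of the form cancels the 2 of
    the parallelogram identity. *)
Lemma code_lattice_form_hadamard_row N n r (C : {vspace 'rV['F_2]_N})
    (h : 'I_N -> 'I_n * bool) (u : {ffun 'I_(n + n) -> int}) :
  (forall ib, #|[pred j | h j == ib]| = r) ->
  @form (code_lattice C) (hadamard_row h u) (hadamard_row h u)
  = @form (power_lattice (scaled_lattice A1 r) (n + n)) u u.
Proof.
move=> h_fib; rewrite /= /code_lattice_form /power_form /=.
rewrite (partition_big h xpredT) //= big_split_ord /= -big_split /=.
pose F ib : rat :=
  (u (lshift n ib.1)
   + (if ib.2 then - u (rshift n ib.1) else u (rshift n ib.1)))%:~R ^+ 2.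
rewrite (eq_bigr (fun ib => r%:R * (2^-1 * F ib))) => [|ib _]; last first.
  rewrite (eq_bigr (fun _ => 2^-1 * F ib)) => [|j /eqP hj].
    by rewrite sumr_const h_fib mulr_natl.
  by rewrite !mxE hj -mulrA.
rewrite (eq_bigr (fun ib => r%:R * (2^-1 * F (ib.1, ib.2)))) => [|[] //].
rewrite -(pair_bigA _ (fun i b => r%:R * (2^-1 * F (i, b)))) /=.
apply: eq_bigr => i _; rewrite big_bool /F /= /scaled_form /= /A1_form.
by rewrite !rmorphD /= rmorphN; field.
Qed.

(** * Each block consists of exactly two orbits *)

Section Blocks.
Variables (N r : nat) (C : {vspace 'rV['F_2]_N}) (g : 'S_N).
Variable (B : (N %/ (2 * r)).-tuple 'rV['F_2]_N).
Hypothesis C_dual : self_dual C.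
Hypothesis g_aut : g \in Aut_code C.
Hypothesis g_cycle : has_cycle_type_pow g r (N %/ r).
Hypothesis B_span : <<B>>%VS = fixed_subcode C g.
Hypothesis B_disj :
  forall i j, i != j -> [disjoint supp (tnth B i) & supp (tnth B j)].
Hypothesis B_cover : (\bigcup_i supp (tnth B i))%SET = [set: 'I_N]%SET.

Lemma card_porbit_cycle_type j : #|porbit g j| = r.
Proof. by case: g_cycle => _; apply; apply: imset_f. Qed.

Lemma exists_block j : exists i, j \in supp (tnth B i).
Proof.
have : j \in (\bigcup_i supp (tnth B i))%SET by rewrite B_cover inE.
by case/bigcupP => i _; exists i.
Qed.

Lemma mem_fixed_subcode x :
  x \in fixed_subcode C g <->
  x \in C /\ (forall j k, porbit g j = porbit g k -> x 0 j = x 0 k).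
Proof.
rewrite memv_cap; split=> [/andP[-> /fixedSpaceP]|[-> x_orb]] /=.
  by rewrite lfunE => /coord_perm_fixedP.
by apply/fixedSpaceP; rewrite lfunE; apply/coord_perm_fixedP.
Qed.

Lemma coord_perm_expg_code i c : c \in C -> coord_perm (g ^+ i)%g c \in C.
Proof.
have gC d : d \in C -> coord_perm g d \in C.
  move=> dC; move: g_aut; rewrite inE => /eqP <-.
  by rewrite -[coord_perm g d]lfunE; apply: memv_img.
move=> cC; elim: i => [|i IHi]; last by rewrite expgSr coord_permM gC.
suff -> : coord_perm (g ^+ 0)%g c = c by [].
by apply/rowP => j; rewrite coord_permE invg1 perm1.
Qed.

(** The trace of [c] under the group generated by [g]: all orbits have length [r], so it is the sum
    of the [r] translates of [c]. *)
Definition orbit_sums (c : 'rV['F_2]_N) : 'rV['F_2]_N :=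
  \row_j \sum_(k in porbit g j) c 0 k.

Lemma orbit_sums_code c : c \in C -> orbit_sums c \in fixed_subcode C g.
Proof.
move=> cC; apply/mem_fixed_subcode; split=> [|j k jk]; last by rewrite !mxE jk.
suff -> : orbit_sums c = \sum_(i < r) coord_perm (g ^+ i)%g c.
  by apply: memv_suml => i _; apply: coord_perm_expg_code.
by apply/rowP => j; rewrite mxE -sum_coord_perm_expg card_porbit_cycle_type.
Qed.

Lemma two_orbits_code i j k :
  j \in supp (tnth B i) -> k \in supp (tnth B i) ->
  \row_l ((l \in porbit g j)%:R + (l \in porbit g k)%:R) \in fixed_subcode C g.
Proof.
move=> ji ki; apply/mem_fixed_subcode; split=> [|l l' ll']; last first.
  by rewrite !mxE !(porbit_sym g l) ?(porbit_sym g l') -!eq_porbit_mem ll'.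
(* Pairing with [c] gives the trace of [c] at [j] plus that at [k]; these agree, as the trace is
   constant on the block, and cancel modulo 2. *)
apply/C_dual => c /orbit_sums_code; rewrite -B_span => Tc.
have := span_disjoint_supp B_disj Tc ji ki; rewrite !mxE => Tjk.
rewrite /dotF2; under eq_bigr do rewrite mxE mulrDl.
rewrite big_split /=.
under eq_bigr do rewrite mulr_natl mulrb.
under [X in _ + X]eq_bigr do rewrite mulr_natl mulrb.
by rewrite -!big_mkcond /= Tjk addrr_F2.
Qed.

(** The word of [two_orbits_code] is constant on the block and equals 1 at [j], hence is nonzero at
    [l]. *)
Lemma block_sub_two_orbits i j k l :
  j \in supp (tnth B i) -> k \in supp (tnth B i) -> l \in supp (tnth B i) ->
  porbit g j != porbit g k -> (l \in porbit g j) || (l \in porbit g k).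
Proof.
move=> ji ki li; rewrite eq_porbit_mem => /negPf jk.
have := two_orbits_code ji ki; rewrite -B_span => x_span.
have := span_disjoint_supp B_disj x_span li ji.
rewrite !mxE porbit_id jk addr0.
by case: (l \in porbit g j) => //; case: (l \in porbit g k).
Qed.

Definition block_orbits i : {set {set 'I_N}} :=
  [set porbit g j | j in supp (tnth B i)].

Lemma card_block_orbits_le i : (#|block_orbits i| <= 2)%N.
Proof.
rewrite leqNgt; apply/negP => /card_gt2P[X [Y [Z [[]]]]].
move=> /imsetP[j ji ->] /imsetP[k ki ->] /imsetP[l li ->] [jk kl lj].
have := block_sub_two_orbits ji ki li jk.
by rewrite -!eq_porbit_mem (negPf lj) eq_sym (negPf kl).
Qed.

Lemma divn_twice : (N %/ (2 * r) = (N %/ r) %/ 2)%N.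
Proof. by rewrite mulnC divnMA. Qed.

(** The blocks cover all positions, so every orbit meets some block. *)
Lemma sum_card_block_orbits : (N %/ r <= \sum_i #|block_orbits i|)%N.
Proof.
case: g_cycle => <- _.
have -> : porbits g = (\bigcup_i block_orbits i)%SET.
  apply/setP => X; apply/imsetP/bigcupP => [[j _ ->]|[i _ /imsetP[j _ ->]]].
    by have [i ji] := exists_block j; exists i => //; apply: imset_f.
  by exists j.
elim/big_rec2: _ => [|i m S _ IH]; first by rewrite cards0.
by rewrite (leq_trans (leq_card_setU _ _)) // leq_add2l.
Qed.

(** This is where [N %/ r] is seen to be even: at most two orbits per block bounds it by twice the
    truncated quotient, and truncation gives the reverse bound. *)
Lemma divn_double : (N %/ r = N %/ (2 * r) + N %/ (2 * r))%N.
Proof.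
have := sum_card_block_orbits.
have : (\sum_i #|block_orbits i| <= \sum_(i < N %/ (2 * r)) 2)%N.
  by apply: leq_sum => i _; apply: card_block_orbits_le.
rewrite sum_nat_const card_ord => le1 le2.
have := leq_trans le2 le1; move: divn_twice; clear; lia.
Qed.

Lemma card_block_orbits i : #|block_orbits i| = 2.
Proof.
apply/eqP; rewrite eqn_leq card_block_orbits_le leqNgt; apply/negP => lt2.
have := sum_card_block_orbits; rewrite leqNgt => /negP; apply.
have -> : (N %/ r = \sum_(k < N %/ (2 * r)) 2)%N.
  by rewrite sum_nat_const card_ord muln2 -addnn divn_double.
(* Block [i] is isolated: its strict inequality makes the whole sum too small. *)
rewrite (bigD1 i) //= [ltnRHS](bigD1 i) //= -addSn leq_add //.
by apply: leq_sum => k _; apply: card_block_orbits_le.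
Qed.

(** * Labelling orbits by a block and a sign *)

Lemma exists_orbit_labelling :
  exists h : 'I_N -> 'I_(N %/ (2 * r)) * bool,
    [/\ forall j k, h j = h k <-> porbit g j = porbit g k,
        forall j, j \in supp (tnth B (h j).1)
      & forall ib, exists j, h j = ib].
Proof.
have /fin_all_exists[o o_supp] : forall j, exists i, j \in supp (tnth B i).
  exact: exists_block.
(* [p] picks one point in each of the two orbits of a block. *)
have /fin_all_exists[p p_spec] : forall i, exists p : 'I_N * 'I_N,
    [/\ p.1 \in supp (tnth B i), p.2 \in supp (tnth B i)
      & porbit g p.1 != porbit g p.2].
  move=> i; have /eqP/cards2P[X [Y [XY orbE]]] := card_block_orbits i.
  have : X \in block_orbits i by rewrite orbE !inE eqxx.
  have : Y \in block_orbits i by rewrite orbE !inE eqxx orbT.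
  case/imsetP => k ki Yk /imsetP[j ji Xj].
  by exists (j, k); split; rewrite // -Xj -Yk.
have o_uniq i j : j \in supp (tnth B i) -> o j = i.
  by move=> ji; apply: disjoint_supp_uniq B_disj _ _ _ ji (o_supp j).
(* The label of [j] is its block, with [true] for the orbit of the first chosen point. *)
exists (fun j => (o j, j \in porbit g (p (o j)).1)); split=> // [j k|[i b]].
- split=> [[ojk]|jk]; last first.
    (* Words of [B] are fixed by [g], so an orbit never leaves its block. *)
    have ok : o k = o j.
      apply: o_uniq; rewrite mem_supp.
      have /mem_fixed_subcode[_ /(_ j k jk) <-] : tnth B (o j) \in fixed_subcode C g.
        by rewrite -B_span memv_span ?mem_tnth.
      by rewrite -mem_supp.
    by rewrite ok -!eq_porbit_mem jk.
  have [p1 p2 p12] := p_spec (o k); rewrite ojk.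
  have oj := o_supp j; rewrite ojk in oj.
  have := block_sub_two_orbits p1 p2 oj p12.
  have := block_sub_two_orbits p1 p2 (o_supp k) p12.
  rewrite -!eq_porbit_mem.
  case: (porbit g k =P porbit g (p (o k)).1) => [->|_] /=;
    case: (porbit g j =P porbit g (p (o k)).1) => [->|_] //=.
  by move=> /eqP -> /eqP ->.
- have [p1 p2 p12] := p_spec i; case: b.
    by exists (p i).1; rewrite (o_uniq i) // porbit_id.
  by exists (p i).2; rewrite (o_uniq i) // -eq_porbit_mem eq_sym (negPf p12).
Qed.

(** * The fixed lattice as the image of the Hadamard map *)

Lemma image_hadamard_row (h : 'I_N -> 'I_(N %/ (2 * r)) * bool) :
  (forall j k, h j = h k <-> porbit g j = porbit g k) ->
  (forall j, j \in supp (tnth B (h j).1)) ->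
  (forall ib, exists j, h j = ib) ->
  (hadamard_row h @` [set: {ffun 'I_(N %/ (2 * r) + N %/ (2 * r)) -> int}]
   = @points (@fixed_lattice (code_lattice C) (@coord_perm int N g)))%classic.
Proof.
move=> h_orb h_supp h_surj; apply/seteqP; split=> [_ [u _ <-]|a [/= aC a_fix]].
  split=> /=; last by apply/coord_perm_fixedP => j k /h_orb jk; rewrite !mxE jk.
  rewrite /code_lattice_points /=.
  suff : map_mx intr (hadamard_row h u) \in <<B>>%VS.
    by rewrite B_span => /mem_fixed_subcode[].
  apply: mem_span_disjoint_supp exists_block _ => // i j k.
  have h_uniq l : l \in supp (tnth B i) -> (h l).1 = i.
    by move=> li; apply: disjoint_supp_uniq B_disj _ _ _ li (h_supp l).
  move=> /h_uniq ji /h_uniq ki; rewrite !mxE ji ki; apply/intr_F2_eqP.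
  (* The entries [x + y] and [x - y] differ by [2 y]; the witnesses are the half-differences. *)
  case: (h j).2; case: (h k).2;
    [exists 0|exists (- u (rshift _ i))|exists (u (rshift _ i))|exists 0];
    rewrite ?mul0rn ?addr0 // mulr2n; lia.
have {}a_fix : forall j k, porbit g j = porbit g k -> a 0 j = a 0 k.
  exact/coord_perm_fixedP.
have [s hs] := fin_all_exists h_surj.
(* Modulo 2, [a] is a fixed codeword, so its values on the two orbits of a block have the same
   parity; [z] is half their difference. *)
have /fin_all_exists[z az] i :
    exists z : int, a 0 (s (i, false)) = a 0 (s (i, true)) + z *+ 2.
  apply/intr_F2_eqP.
  have aB : map_mx (intr : int -> 'F_2) a \in <<B>>%VS.
    rewrite B_span; apply/mem_fixed_subcode; split=> // j k jk.
    by rewrite !mxE (a_fix j k).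
  have := @span_disjoint_supp _ _ _ B_disj _ i (s (i, false)) (s (i, true)) aB.
  rewrite !mxE; apply.
    by have := h_supp (s (i, false)); rewrite hs.
  by have := h_supp (s (i, true)); rewrite hs.
(* Solving [x - y = a 0 (s (i, true))] and [x + y = a 0 (s (i, false))] gives [y = z i] and this
   [x]. *)
pose u : {ffun 'I_(N %/ (2 * r) + N %/ (2 * r)) -> int} :=
  [ffun k => match fintype.split k with
             | inl i => a 0 (s (i, true)) + z i
             | inr i => z i
             end].
exists u => //.
apply/rowP => j; rewrite !mxE !ffunE.
rewrite (unsplitK (inl _)) (unsplitK (inr _)).
have -> : a 0 j = a 0 (s (h j)) by apply/a_fix/h_orb; rewrite hs.
by case: (h j) => i [] /=; rewrite ?az ?mulr2n ?addrA ?addrK.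
Qed.

Lemma theta_fixed_lattice :
  theta (@fixed_lattice (code_lattice C) (@coord_perm int N g))
  = theta (power_lattice (scaled_lattice A1 r) (N %/ r)).
Proof.
have [h [h_orb h_supp h_surj]] := exists_orbit_labelling.
rewrite divn_double; apply: qsum_bij (hadamard_row_inj h_surj) _ _.
  rewrite -(image_hadamard_row h_orb h_supp h_surj); congr image.
  by apply/seteqP; split.
move=> u _; congr (_ / 2); apply: code_lattice_form_hadamard_row => ib.
(* A fibre of [h] is a single orbit, hence has [r] elements. *)
have [j0 <-] := h_surj ib; rewrite -[RHS](card_porbit_cycle_type j0).
apply: eq_card => j; rewrite !inE -eq_porbit_mem.
by apply/eqP/eqP => /h_orb.
Qed.

End Blocks.

Theorem theoremB (N r : nat) (C : {vspace 'rV['F_2]_N}) (g : 'S_N)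
    (B : (N %/ (2 * r)).-tuple 'rV['F_2]_N) :
  doubly_even C ->
  self_dual C ->
  (0 < r)%N ->
  (r %| N)%N ->
  g \in Aut_code C ->
  has_cycle_type_pow g r (N %/ r) ->
  (\dim (fixed_subcode C g))%:R = r%:R^-1 * (\dim C)%:R :> rat ->
  <<B>>%VS = fixed_subcode C g ->
  (forall i j, i != j -> [disjoint supp (tnth B i) & supp (tnth B j)]) ->
  (\bigcup_i supp (tnth B i))%SET = [set: 'I_N]%SET ->
  let Lg := @fixed_lattice (code_lattice C) (@coord_perm int N g) in
  theta Lg = qpow (qsubst vartheta3 r) (N %/ r) /\
  theta Lg = theta (power_lattice (scaled_lattice A1 r) (N %/ r)).
Proof.
move=> _ C_dual r_gt0 _ g_aut g_cycle _ B_span B_disj B_cover Lg.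
have thetaE : theta Lg = theta (power_lattice (scaled_lattice A1 r) (N %/ r)).
  exact: theta_fixed_lattice C_dual g_aut g_cycle B_span B_disj B_cover.
split=> //; rewrite thetaE theta_power_lattice; last exact: locally_finite_scaled_A1.
by rewrite theta_scaled_lattice // theta_A1.
Qed.
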